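(* For every $a,b\in\mathbb{R}$ with $0<a<b$ there exist a pair of absolutely continuous probability measures $\mu_f,\mu_g$ supported on $[a,b]$ with unimodal $C^\infty$ densities $f,g$ and a strictly increasing sequence of positive integers $(\ell_n)_{n\in\mathbb{N}}$ such that $s_{\ell_n}(\mu_f)<s_{\ell_n}(\mu_g)$ for odd $n\in\mathbb{N}$ and $s_{\ell_n}(\mu_f)>s_{\ell_n}(\mu_g)$ for even $n\in\mathbb{N}$.
   Context: $\mathbb{N}=\{0,1,2,\dots\}$. The moments of $\mu$ are $s_k(\mu)=\int_0^\infty t^k\,d\mu(t)$, $k\in\mathbb{N}$. Densities are with respect to Lebesgue measure and are $C^\infty$ functions on $\mathbb{R}$ with support contained in $[a,b]$. A density is unimodal if it is continuous, has compact support and has one unique local maximum, where only points at which the density is positive are counted as local maxima (points where the density vanishes are disregarded). *)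

(* Defs.v *)
From HB Require Import structures.
From mathcomp Require Import all_boot all_order all_algebra.
From mathcomp Require Import all_classical all_reals all_analysis.

Set Implicit Arguments.
Unset Strict Implicit.
Unset Printing Implicit Defensive.

Import Order.TTheory GRing.Theory Num.Theory.
Import numFieldNormedType.Exports.

Local Open Scope classical_set_scope.
Local Open Scope ring_scope.

Definition smooth (R : realType) (f : R -> R) : Prop :=
  forall (n : nat) (x : R), derivable (derive1n n f) x 1.

Definition fsupp (R : realType) (f : R -> R) : set R :=
  closure [set x | f x != 0].

Definition local_max_at (R : realType) (f : R -> R) (x : R) : Prop :=
  \forall y \near x, f y <= f x.

(* A local maximum is a point, so a positive plateau is excluded: each of its
   interior points is a local maximum, since the inequality is not strict. *)
Definition unimodal (R : realType) (f : R -> R) : Prop :=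
  [/\ continuous f,
      compact (fsupp f) &
      exists! x : R, 0 < f x /\ local_max_at f x].

Definition has_density (R : realType)
    (mu : probability (measurableTypeR R) R) (f : R -> R) : Prop :=
  [/\ measurable_fun [set: measurableTypeR R] f,
      forall x, 0 <= f x &
      forall A : set (measurableTypeR R), measurable A ->
        mu A = (\int[lebesgue_measure]_(x in A) (f x)%:E)%E].

Definition absolutely_continuous (R : realType)
    (mu : probability (measurableTypeR R) R) : Prop :=
  mu `<< (@lebesgue_measure R).

Definition supported_on (R : realType)
    (mu : probability (measurableTypeR R) R) (A : set R) : Prop :=
  mu (~` A) = 0%E.

(* Extended-real valued, so that no junk value is assigned to an infinite
   moment. *)
Definition moment (R : realType)
    (mu : probability (measurableTypeR R) R) (k : nat) : \bar R :=
  (\int[mu]_(t in `[0%R, +oo[%classic) ((t : R) ^+ k)%:E)%E.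

(* Main.v *)
Require Import Defs.
From HB Require Import structures.
From mathcomp Require Import all_boot all_order all_algebra.
From mathcomp Require Import all_classical all_reals all_analysis.
From mathcomp Require Import measurable_realfun ring lra.

Import Order.TTheory GRing.Theory Num.Theory.
Import numFieldNormedType.Exports.

Local Open Scope classical_set_scope.
Local Open Scope ring_scope.

(** Both densities have the form
    rho_al t = c * exp (- 1 / w) * (2 + sin (al - om * ln w)),
    w = (t - a) * (b - t),
    on the interval where w > 0, and vanish elsewhere; f takes al and g takes
    al + pi, so that f - g is 2 * c times the wave
    exp (- 1 / w) * sin (al - om * ln w).

    The factor exp (- 1 / w) beats every negative power of w, so the derivatives
    of such functions have the same shape, with polynomial coefficients and a
    higher negative power of w, and vanish at a and b; this is smoothness
    ([is_derive_flat], [smooth_flat]).  As a function of w alone the density is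
    increasing when om is small, hence its derivative in t vanishes
    between a and b only together with w'; the only critical point is the midpoint, and a
    maximum exists by compactness ([unimodal_rippled]).

    The integral of the wave is a linear combination of cos al and sin al, so it
    changes sign between al = 0 and al = pi and vanishes for some al
    ([exists_balanced_phase]).  For this al the two densities need the same
    normalizing constant c, and the k-th moments of f and g differ by 2 * c
    times the k-th moment of the wave.

    As k grows, t ^ k * exp (- 1 / w) concentrates where b - t is comparable to
    d, with k of order 1 / d ^ 2.  The wave is a function of ln w oscillating
    slowly when om is small: it keeps its sign on an interval of ln w much wider
    than the one on which the weight concentrates.  Choosing d at a crest of the
    sine, and k accordingly, makes the moment of the wave positive
    ([window_dominates], [wave_moment_gt0]).  Crests accumulate at b, so there
    are arbitrarily large such k ([exists_wave_moment_gt0]); replacing al by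
    al + pi changes the sign of the wave and yields arbitrarily large k of the
    other kind.  Picking alternately from the two families gives the
    sequence. *)

(** * Smoothness of flat functions *)

Section flat.
Context {R : realType}.
Implicit Types (w P Q S : {poly R}) (om al t : R) (n : nat).

Definition phase w om al t : R := al - om * ln w.[t].

(** The family is closed under differentiation, which is why it carries three
    arbitrary polynomial coefficients and an arbitrary negative power of w. *)
Definition flat w om al n P Q S t : R :=
  if 0 < w.[t]
  then expR (- w.[t]^-1) * w.[t] ^- n *
    (P.[t] * sin (phase w om al t) + Q.[t] * cos (phase w om al t) + S.[t])
  else 0.

(** A single term of the exponential series at 1 / x, of order n + 2, absorbs the
    pole and leaves a factor x ^ 2. *)
Lemma expRNV_le n (x : R) : 0 < x ->
  expR (- x^-1) * x ^- n <= (n.+2)`!%:R * x ^+ 2.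
Proof.
move=> x0.
have h := expR_ge1Dxn n.+1 (ltW (eq_ind_r is_true x0 (invr_gt0 x))).
have fp : 0 < (n.+2)`!%:R :> R by rewrite ltr0n fact_gt0.
have {h} : x ^- n.+2 <= (n.+2)`!%:R * expR x^-1.
  rewrite -ler_pdivrMl// mulrC -exprVn (le_trans _ h)//.
  by rewrite lerDr.
rewrite expRN => h.
rewrite ler_pdivrMl ?expR_gt0// mulrCA.
have -> : x ^- n = x ^- n.+2 * x ^+ 2.
  rewrite -addn2 exprD invfM -mulrA mulVf ?mulr1//.
  by rewrite expf_neq0// gt_eqF.
by rewrite mulrA ler_wpM2r// exprn_ge0// ltW.
Qed.

Lemma is_derive0_of_sqr_bound (F B : R -> R) t : F t = 0 ->
  {for t, continuous B} -> (forall x, `|F x| <= (x - t) ^+ 2 * B x) ->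
  is_derive t 1 F 0.
Proof.
move=> Ft cB hF.
suff h : h^-1 *: ((F \o shift t) (h *: (1 : R)) - F t) @[h --> 0^'] --> (0 : R).
  apply: DeriveDef; first by apply/cvg_ex; exists 0.
  by apply/cvg_lim.
have hB : (fun h : R => `|h| * B (h + t)) @ 0^' --> (0 : R).
  have cBt : (fun h : R => B (h + t)) @ (0 : R) --> B t.
    have ct : (fun h : R => h + t) @ (0 : R) --> t.
      have : (fun h : R => h + t) @ (0 : R) --> 0 + t.
        by apply: cvgD; [exact: cvg_id|exact: cvg_cst].
      by rewrite add0r.
    exact: (cvg_comp _ _ ct cB).
  have : (fun h : R => `|h| * B (h + t)) @ (0 : R) --> `|0 : R| * B t.
    by apply: cvgM => //; exact: (cvg_norm cvg_id).
  by rewrite normr0 mul0r => h; exact: cvg_within_filter.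
apply: norm_cvg0.
apply: (squeeze_cvgr _ (cvg_cst 0) hB).
near=> h.
have h0 : h != 0 by near: h; exact: nbhs_dnbhs_neq.
rewrite normr_ge0/= Ft subr0 /= [_ *: 1]mulr1.
have := hF (h + t); rewrite addrK => hh.
have -> : h^-1 *: F (h + t) = h^-1 * F (h + t) by [].
rewrite normrM normfV.
rewrite ler_pdivrMl ?normr_gt0// (le_trans hh)// mulrA.
by rewrite -expr2 -normrX ger0_norm ?sqr_ge0.
Unshelve. all: by end_near. Qed.

(** At a zero of w, and wherever w <= 0, this makes the function quadratically
    small: w x is positive and w t is not, so w x is at most their
    difference. *)
Lemma flat_le n w om al P Q S t x : w.[t] <= 0 ->
  `|flat w om al n P Q S x| <= (w.[x] - w.[t]) ^+ 2 *
    ((n.+2)`!%:R * (`|P.[x]| + `|Q.[x]| + `|S.[x]|)).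
Proof.
move=> wt; rewrite /flat; case: ifPn => [wx|_]; last first.
  by rewrite normr0 mulr_ge0 ?sqr_ge0// mulr_ge0 ?ler0n.
rewrite normrM ger0_norm; last first.
  by rewrite mulr_ge0 ?expR_ge0// invr_ge0 exprn_ge0// ltW.
rewrite mulrA; apply: ler_pM => //.
- by rewrite mulr_ge0 ?expR_ge0// invr_ge0 exprn_ge0// ltW.
- rewrite (le_trans (expRNV_le n _ wx))// mulrC ler_wpM2r ?ler0n//.
  by rewrite ler_sqr ?nnegrE; lra.
- rewrite (le_trans (ler_normD _ _))// lerD2r (le_trans (ler_normD _ _))//.
  by rewrite !normrM lerD// ler_piMr// ?sin_max ?cos_max.
Qed.

(** Where w > 0 this is the chain rule; where w <= 0 both sides vanish, because
    w - w t is divisible by X - t and [flat_le] then bounds the function by a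
    multiple of (x - t) ^ 2. *)
Lemma is_derive_flat n w om al P Q S t :
  is_derive t 1 (flat w om al n P Q S)
   (flat w om al n.+2
      (P^`() * w ^+ 2 + (1 - n%:R *: w) * w^`() * P + om *: (w * w^`() * Q))
      (Q^`() * w ^+ 2 + (1 - n%:R *: w) * w^`() * Q - om *: (w * w^`() * P))
      (S^`() * w ^+ 2 + (1 - n%:R *: w) * w^`() * S) t).
Proof.
have [wt|wt] := leP w.[t] 0.
  rewrite [X in is_derive _ _ _ X]/flat ltNge wt/=.
  have [q qE] : exists q, w - w.[t]%:P = q * ('X - t%:P).
    by apply/factor_theorem; rewrite rootE !hornerE subrr.
  apply: (@is_derive0_of_sqr_bound _ (fun x => q.[x] ^+ 2 *
    ((n.+2)`!%:R * (`|P.[x]| + `|Q.[x]| + `|S.[x]|)))).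
  - by rewrite /flat ltNge wt.
  - have cp (p : {poly R}) : {for t, continuous (fun x => p.[x])}.
      exact: continuous_horner.
    have cn (p : {poly R}) : {for t, continuous (fun x => `|p.[x]|)}.
      exact: (cvg_norm (cp p)).
    apply: cvgM; first by apply: (@cvgM _ _ _ _ (horner q) (horner q)); exact: cp.
    apply: cvgM; first exact: cvg_cst.
    by apply: cvgD; [apply: cvgD|]; exact: cn.
  - move=> x; rewrite (le_trans (flat_le _ _ _ _ _ _ _ _ _ wt))//.
    have -> : w.[x] - w.[t] = q.[x] * (x - t).
      by have /(congr1 (horner^~ x)) := qE; rewrite !hornerE.
    by rewrite exprMn -mulrA mulrCA.
have w0 : w.[t] != 0 by rewrite gt_eqF.
(* With the power of w moved into the exponent, the chain rule needs only the
   derivatives of 1 / w and ln w. *)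
pose e x := expR (- (w.[x])^-1 - n%:R * ln w.[x]).
have eE x : 0 < w.[x] -> expR (- w.[x]^-1) * w.[x] ^- n = e x.
  by move=> wx; rewrite /e expRB expRM_natl lnK// posrE.
apply: (@near_eq_is_derive _ _ _ (fun x => e x *
    (P.[x] * sin (phase w om al x) + Q.[x] * cos (phase w om al x) + S.[x]))).
  near=> x.
  have wx : 0 < w.[x].
    near: x; apply: (@cvgr_gt _ _ _ _ (horner w) w.[t]) => //.
    exact: continuous_horner.
  by rewrite /flat wx eE.
have dw : is_derive t 1 (fun x => w.[x]) w^`().[t] by exact: is_derive_poly.
have dP (p : {poly R}) : is_derive t 1 (fun x => p.[x]) p^`().[t].
  exact: is_derive_poly.
have dln : is_derive t 1 (fun x => ln w.[x]) (w.[t]^-1 * w^`().[t]).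
  exact: (@is_derive1_comp _ (@ln R) (horner w) t _ _ (is_derive1_ln wt) dw).
have dinv : is_derive t 1 (fun x => (w.[x])^-1) (- w.[t] ^- 2 *: w^`().[t]).
  exact: is_deriveV.
have dph : is_derive t 1 (phase w om al) (- om * (w.[t]^-1 * w^`().[t])).
  have -> : phase w om al = cst al - om \*: (fun x => ln w.[x]).
    by apply/funext.
  apply: is_derive_eq; rewrite sub0r mulNr; reflexivity.
have de : is_derive t 1 e
    ((- (- w.[t] ^- 2 *: w^`().[t]) - n%:R *: (w.[t]^-1 * w^`().[t])) *: e t).
  have -> : e = @expR R \o
      (- (fun x => w.[x]^-1) - n%:R \*: (fun x => ln w.[x])) by apply/funext.
  by rewrite [X in is_derive _ _ _ X]mulrC; apply: is_derive1_comp.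
have ds : is_derive t 1 (fun x => sin (phase w om al x))
    (cos (phase w om al t) * (- om * (w.[t]^-1 * w^`().[t]))).
  exact: (@is_derive1_comp _ (@sin R) (phase w om al) t _ _ (is_derive_sin _) dph).
have dc : is_derive t 1 (fun x => cos (phase w om al x))
    (- sin (phase w om al t) * (- om * (w.[t]^-1 * w^`().[t]))).
  exact: (@is_derive1_comp _ (@cos R) (phase w om al) t _ _ (is_derive_cos _) dph).
rewrite (_ : (fun x => _) = e * ((fun x => P.[x]) * (fun x => sin (phase w om al x)) +
    (fun x => Q.[x]) * (fun x => cos (phase w om al x)) + (fun x => S.[x]))); last first.
  by apply/funext.
have H1 := is_deriveM (dP P) ds.
have H2 := is_deriveM (dP Q) dc.
have H3 := is_deriveD (is_deriveD H1 H2) (dP S).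
have H4 := is_deriveM de H3.
apply: (is_derive_eq H4); rewrite !fctE /flat wt.
have -> : expR (- w.[t]^-1) * w.[t] ^- n.+2 = e t / w.[t] ^+ 2.
  by rewrite -eE// -mulrA -invfM -exprD addn2.
rewrite !(hornerD, hornerN, hornerM, hornerZ, hornerXn, hornerC, horner_exp).
move: (e t) (sin _) (cos _) => E s c.
have sE (x y : R) : x *: y = x * y by [].
rewrite !sE.
by field.
Unshelve. all: by end_near. Qed.

Lemma continuous_flat n w om al P Q S : continuous (flat w om al n P Q S).
Proof.
move=> t; apply/differentiable_continuous/derivable1_diffP.
exact: (@ex_derive _ _ _ _ _ _ _ (is_derive_flat n w om al P Q S t)).
Qed.

Lemma smooth_flat n w om al P Q S c : smooth (fun t => c * flat w om al n P Q S t).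
Proof.
move=> k t.
suff [m [P' [Q' [S' ->]]]] : exists m P' Q' S',
    derive1n k (fun t => c * flat w om al n P Q S t)
    = c \*: flat w om al m P' Q' S'.
  exact: (@ex_derive _ _ _ _ _ _ _ (is_deriveZ c (is_derive_flat m w om al P' Q' S' t))).
elim: k => [|k [m [P' [Q' [S' ih]]]]]; first by exists n, P, Q, S.
rewrite derive1nS ih; do 4 eexists; apply/funext => x.
rewrite derive1E.
exact: (@derive_val _ _ _ _ _ _ _ (is_deriveZ c (is_derive_flat m w om al P' Q' S' x))).
Qed.

End flat.

(** * Unimodality *)

Section rippled.
Context {R : realType}.
Implicit Types (a b om al c t : R).

Definition parab a b : {poly R} := ('X - a%:P) * (b%:P - 'X).

Lemma horner_parab a b t : (parab a b).[t] = (t - a) * (b - t).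
Proof. by rewrite /parab !(hornerM, hornerD, hornerN, hornerX, hornerC). Qed.

Lemma parab_gt0 a b t : a < b -> (0 < (parab a b).[t]) = (a < t < b).
Proof.
move=> ab; rewrite horner_parab; apply/idP/andP => [h|[at_ tb]]; last first.
  by rewrite mulr_gt0 ?subr_gt0.
have [ta|at_] := leP t a; first by exfalso; nra.
by split => //; rewrite ltNge; apply/negP => bt; nra.
Qed.

Definition rippled a b om al : R -> R := flat (parab a b) om al 0 1 0 2%:P.

Lemma rippled_out a b om al t : a < b -> ~~ (a < t < b) -> rippled a b om al t = 0.
Proof. by move=> ab nt; rewrite /rippled /flat parab_gt0// (negbTE nt). Qed.

Lemma rippled_gt0 a b om al t : a < b -> a < t < b -> 0 < rippled a b om al t.
Proof.
move=> ab tab; rewrite /rippled /flat parab_gt0// tab expr0 invr1 mulr1.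
rewrite mulr_gt0 ?expR_gt0// !hornerC mul1r mul0r addr0.
by have := sin_geN1 (phase (parab a b) om al t); lra.
Qed.

Lemma rippled_ge0 a b om al t : a < b -> 0 <= rippled a b om al t.
Proof.
move=> ab; have [tab|ntab] := boolP (a < t < b); first by rewrite ltW// rippled_gt0.
by rewrite rippled_out.
Qed.

Lemma continuous_rippled a b om al : continuous (rippled a b om al).
Proof. exact: continuous_flat. Qed.

Lemma local_max_is_derive0 (f : R -> R) x :
  (forall t, derivable f t 1) -> local_max_at f x -> is_derive x 1 f 0.
Proof.
move=> df /nbhs_ballP[e /= e0 h].
apply: (@derive1_at_max _ _ (x - e) (x + e)) => //.
- by rewrite lerD2l ge0_cp ?ltW.
- by rewrite in_itv/= ltrDl ltrBlDr ltrDl e0.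
- move=> t; rewrite in_itv/= => /andP[t1 t2]; apply: h.
  by rewrite /ball/= ltr_norml; apply/andP; split; lra.
Qed.

(** The derivative is w' * exp (- 1 / w) / w ^ 2 * (2 + sin - om * w * cos), and
    the last factor is positive since om * w < 1. *)
Lemma rippled_critical a b om al x : a < b -> 0 <= om -> om * (b - a) ^+ 2 < 1 ->
  a < x < b -> is_derive x 1 (rippled a b om al) 0 -> x = (a + b) / 2.
Proof.
move=> ab om0 omab xab /(@derive_val _ _ _ _ _ _ _) d0.
have := @derive_val _ _ _ _ _ _ _
  (is_derive_flat 0 (parab a b) om al 1 0 2%:P x).
rewrite -/(rippled a b om al) d0 /flat parab_gt0// xab => /esym/eqP {d0}.
have wx : 0 < (parab a b).[x] by rewrite parab_gt0.
have dwx : (parab a b)^`().[x] = a + b - 2 * x.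
  rewrite /parab derivM !derivB !derivX !derivC.
  by rewrite !(hornerM, hornerD, hornerN, hornerX, hornerC); ring.
have wE := horner_parab a b x.
move: (parab a b) wx dwx wE => w wx dwx wE.
rewrite mulf_eq0 gt_eqF/=; last by rewrite divr_gt0 ?expR_gt0 ?exprn_gt0.
rewrite scale0r subr0 !derivC !mul0r !add0r mulr0 scaler0 addr0.
rewrite !mul1r mulr1.
rewrite !(hornerD, hornerN, hornerM, hornerZ, hornerXn, hornerC, horner_exp) dwx.
have := sin_geN1 (phase w om al x).
have := cos_le1 (phase w om al x).
set W := w.[x]; set s := sin _; set c := cos _ => c1 s1.
rewrite [X in X == 0](_ : _ = (a + b - 2 * x) * (s - om * W * c + 2)); last by ring.
rewrite mulf_eq0 => /orP[/eqP|/eqP]; first by lra.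
have : om * W <= om * (b - a) ^+ 2.
  rewrite ler_wpM2l// /W wE expr2.
  by move/andP: xab => [x1 x2]; apply: ler_pM; lra.
have : 0 <= om * W by rewrite mulr_ge0// ltW.
nra.
Qed.

Lemma fsupp_rippled a b om al c : a < b ->
  fsupp (fun t => c * rippled a b om al t) `<=` `[a, b].
Proof.
move=> ab; rewrite [X in _ `<=` X]((closure_id _).1
  (@interval_closed R (BLeft a) (BRight b) isT isT)).
apply: closureS => t /=; rewrite in_itv/=.
have [/andP[t1 t2] _|nt] := boolP (a < t < b); first by rewrite !ltW.
by rewrite rippled_out// mulr0 eqxx.
Qed.

(** The maximum on [a, b] given by compactness is positive and global, so it is a
    critical point between a and b; any other positive local maximum would be another
    one. *)
Lemma unimodal_rippled a b om al c : a < b -> 0 <= om ->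
  om * (b - a) ^+ 2 < 1 -> 0 < c ->
  unimodal (fun t => c * rippled a b om al t).
Proof.
move=> ab om0 omab c0.
have db t : derivable (rippled a b om al) t 1.
  exact: (@ex_derive _ _ _ _ _ _ _ (is_derive_flat 0 (parab a b) om al 1 0 2%:P t)).
split.
- by move=> t; apply: cvgM; [exact: cvg_cst|exact: continuous_rippled].
- apply: (subclosed_compact _ (@segment_compact _ a b)); last exact: fsupp_rippled.
  exact: closed_closure.
have critical x : 0 < c * rippled a b om al x ->
    local_max_at (fun t => c * rippled a b om al t) x -> x = (a + b) / 2.
  rewrite pmulr_rgt0// => fx mx.
  have xab : a < x < b by apply: contraTT fx => /rippled_out ->//; rewrite ltxx.
  apply: (rippled_critical _ _ om al) => //.
  apply: local_max_is_derive0 => //.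
  by apply: filterS mx => t; rewrite ler_pM2l.
have [x xab mx] := EVT_max (ltW ab)
  (continuous_subspaceT (@continuous_rippled a b om al)).
have fx : 0 < rippled a b om al x.
  rewrite (@lt_le_trans _ _ (rippled a b om al ((a + b) / 2)))//.
    by apply: rippled_gt0 => //; lra.
  by apply: mx; rewrite in_itv/=; lra.
have lx : local_max_at (fun t => c * rippled a b om al t) x.
  near=> t; rewrite ler_pM2l//.
  have [tab|ntab] := boolP (t \in `[a, b]%R); first exact: mx.
  rewrite rippled_out ?ltW//; apply: contra ntab => /andP[? ?].
  by rewrite in_itv/= !ltW.
exists x; split; first by split => //; rewrite mulr_gt0.
move=> y [fy ly]; rewrite (critical y)// (critical x)//.
by rewrite mulr_gt0.
Unshelve. all: by end_near. Qed.

End rippled.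

(** * Probability measures with a density *)

Section density.
Context {R : realType}.
Local Notation leb := (@lebesgue_measure R).
Implicit Types (f : R -> R) (mu : probability (measurableTypeR R) R).

Lemma exists_density f : measurable_fun [set: measurableTypeR R] f ->
  (forall x, 0 <= f x) -> (\int[leb]_x (f x)%:E)%E = 1%E ->
  exists mu, has_density mu f.
Proof.
move=> mf f0 f1.
pose nu (A : set (measurableTypeR R)) : \bar R := (\int[leb]_(x in A) (f x)%:E)%E.
have nu0 : nu set0 = 0%E by rewrite /nu integral_set0.
have nu_ge0 A : (0 <= nu A)%E by apply: integral_ge0 => x _; rewrite lee_fin.
have nu_sa : semi_sigma_additive nu.
  move=> /= F mF tF mUF; rewrite /nu; apply: cvg_toP.
    apply: ereal_nondecreasing_is_cvgn => m n mn.
    apply: lee_sum_nneg_natr => // k _ _; apply: integral_ge0 => /= x Fkx.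
    by rewrite lee_fin.
  rewrite ge0_integral_bigcup//=.
  - by apply/measurable_EFinP; exact: measurable_funTS.
  - by move=> x _; rewrite lee_fin.
pose nuM := isMeasure.Build _ _ _ nu nu0 nu_ge0 nu_sa.
pose numeas : {measure set (measurableTypeR R) -> \bar R} := HB.pack nu nuM.
pose nuP := @Measure_isProbability.Build _ _ R numeas f1.
pose nuprob : probability (measurableTypeR R) R := HB.pack nu nuM nuP.
by exists nuprob.
Qed.

Lemma has_density_dominates mu f : has_density mu f -> absolutely_continuous mu.
Proof.
move=> [mf f0 muE]; apply/null_content_dominatesP => A mA A0.
rewrite muE//; apply: null_set_integral => //.
by apply/measurable_EFinP; exact: measurable_funTS.
Qed.

(** The integrand is replaced by |t| ^ k, nonnegative on the whole line, because
    the change of variables for nonnegative functions asks for no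
    integrability. *)
Lemma moment_density mu f k : has_density mu f ->
  moment mu k = (\int[leb]_(t in `[0%R, +oo[) (t ^+ k * f t)%:E)%E.
Proof.
move=> df; have numu := has_density_dominates _ _ df.
have [mf f0 muE] := df.
pose D : set (measurableTypeR R) := `[0%R, +oo[%classic.
pose g (t : measurableTypeR R) : \bar R := (`|t : R| ^+ k)%:E.
have mD : measurable D by exact: measurable_itv.
have mg : measurable_fun D g.
  apply/measurable_EFinP; apply: measurable_funX; exact: measurable_funTS.
have absE t : D t -> (`|t : R| ^+ k) = t ^+ k.
  by rewrite /D/= in_itv/= andbT => t0; rewrite ger0_norm.
transitivity (\int[mu]_(t in D) g t)%E.
  by apply: eq_integral => t; rewrite inE => Dt; rewrite /g absE.
rewrite -(Radon_Nikodym_SigmaFinite.change_of_variables numu)//; last first.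
  by move=> t; rewrite lee_fin exprn_ge0.
have mEf : measurable_fun [set: measurableTypeR R] (EFin \o f).
  exact/measurable_EFinP.
transitivity (\int[leb]_(t in D) (g t * (f t)%:E))%E; last first.
  by apply: eq_integral => t; rewrite inE => Dt; rewrite /g absE.
have iRN := Radon_Nikodym_SigmaFinite.f_integrable numu.
apply: ae_eq_integral => //.
- apply: emeasurable_funM => //; apply: measurable_funTS.
  exact: measurable_int iRN.
- by apply: emeasurable_funM => //; exact: measurable_funTS.
- apply: ae_eqe_mul2l; apply: integral_ae_eq => //.
  + exact: integrableS iRN.
  + exact: measurable_funTS.
  + move=> E _ mE.
    by rewrite -(Radon_Nikodym_SigmaFinite.f_integral numu)//; exact: muE.
Qed.

Lemma has_density_supported mu f (A : set (measurableTypeR R)) :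
  measurable A -> has_density mu f -> (forall x, ~ A x -> f x = 0) ->
  supported_on mu A.
Proof.
move=> mA [mf f0 muE] fA; rewrite /supported_on muE; last exact: measurableC.
by apply: integral0_eq => x Ax; rewrite fA.
Qed.

End density.

(** * A window near the right endpoint dominates a moment *)

Section window.
Context {R : realType}.
Implicit Types (b l d x : R).

(** Doubling the angle stays within 1 <= pi / 2, so 2 * cos x ^ 2 - 1 >= 0, and
    cos x <= 1 gives cos x >= cos x ^ 2 >= 1 / 2. *)
Lemma cos_ge_half x : `|x| <= 1 / 2 -> 1 / 2 <= cos x.
Proof.
rewrite ler_norml => /andP[x1 x2].
have p1 := @pihalf_ge1 R.
have c2 : 0 <= cos (x *+ 2) by apply: cos_ge0_pihalf; rewrite [x *+ 2]mulr2n; lra.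
have c1 : 0 < cos x by apply: cos_gt0_pihalf; lra.
have := cos_le1 x; move: c2; rewrite cos_mulr2n [_ ^+ 2 *+ 2]mulr2n expr2 => c2 c3.
nra.
Qed.

(** The sine will be kept away from 0 for b - t between d / spread l and 3 * d.
    The value makes spread l / (l * d) equal to 9 times the quantity
    (4 * l + 2 / l) / d, which is comparable to k * d / b in
    [window_dominates]. *)
Definition spread l : R := 36 * l ^+ 2 + 18.

(** The right-hand side bounds from below the contribution of
    b - 2 * d <= t <= b - d to the k-th moment of the wave, and the left-hand
    side bounds from above the negative contributions: those of t <= b - 3 * d,
    where t ^ k is too small, and those of t > b - d / spread l, where
    exp (- 1 / w) is too small.  With T = k * d / b, the first is at most
    (b - 2 * d) ^ k * exp (- T) and the second at most
    (b - 2 * d) ^ k * exp (4 * T - spread l / (l * d)); these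
    two exponents pull k in opposite directions and both are negative enough
    when k * d ^ 2 lies between the two given bounds. *)
Lemma window_dominates b l d k : 0 < d -> 6 * d <= l -> l < b ->
  (4 * l + 2 / l) * b <= k%:R * d ^+ 2 ->
  k%:R * d ^+ 2 <= 2 * (4 * l + 2 / l) * b ->
  l * ((b - 3 * d) ^+ k + b ^+ k * expR (- (spread l / (l * d)))) <
  d * (1 / 2 * (b - 2 * d) ^+ k * expR (- (2 / (l * d)))).
Proof.
move=> d0 dl lb k1 k2.
have l0 : 0 < l by lra.
have b0 : 0 < b by lra.
pose T := k%:R * (d / b).
set X := (b - 2 * d) ^+ k.
have X0 : 0 < X by rewrite exprn_gt0//; lra.
have db : d / b < 1 by rewrite ltr_pdivrMr//; lra.
have dbb : d / b * b = d by rewrite divfK// gt_eqF.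
have db0 : 0 < d / b by rewrite divr_gt0.
have h1 : (b - 3 * d) ^+ k <= X * expR (- T).
  have -> : expR (- T) = expR (- (d / b)) ^+ k by rewrite -expRM_natl mulrN.
  rewrite -exprMn; apply: lerXn2r; rewrite ?nnegrE.
  - by lra.
  - by rewrite mulr_ge0 ?expR_ge0//; lra.
  - apply: (@le_trans _ _ ((b - 2 * d) * (1 + - (d / b)))).
      by nra.
    by rewrite ler_wpM2l ?expR_ge1Dx//; lra.
have h2 : b ^+ k <= X * expR (4 * T).
  have -> : expR (4 * T) = expR (4 * (d / b)) ^+ k by rewrite -expRM_natl mulrCA.
  rewrite -exprMn; apply: lerXn2r; rewrite ?nnegrE.
  - by lra.
  - by rewrite mulr_ge0 ?expR_ge0//; lra.
  - apply: (@le_trans _ _ ((b - 2 * d) * (1 + 4 * (d / b)))).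
      by nra.
    by rewrite ler_wpM2l ?expR_ge1Dx//; lra.
(* The factor 4 * l / d lost in comparing the lengths l and d is itself
   absorbed by an exponential. *)
have h3 : l < d / 4 * expR (4 * l / d).
  rewrite -ltr_pdivrMl ?divr_gt0// invf_div mulrAC.
  by have := expR_ge1Dx (4 * l / d); lra.
have TE : T * d = k%:R * d ^+ 2 / b by rewrite /T expr2; field; rewrite gt_eqF.
have T1 : 4 * l / d + 2 / (l * d) <= T.
  have -> : 4 * l / d + 2 / (l * d) = (4 * l + 2 / l) / d.
    by field; rewrite !gt_eqF.
  by rewrite ler_pdivrMr// TE ler_pdivlMr.
have T2 : T <= 2 * (4 * l / d + 2 / (l * d)).
  have -> : 4 * l / d + 2 / (l * d) = (4 * l + 2 / l) / d.
    by field; rewrite !gt_eqF.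
  by rewrite mulrA ler_pdivlMr// TE ler_pdivrMr.
have AE : spread l / (l * d) = 9 * (4 * l / d + 2 / (l * d)).
  by rewrite /spread; field; rewrite !gt_eqF.
set q := 2 / (l * d) in T1 T2 AE *; set p := 4 * l / d in h3 T1 T2 AE.
have half s e : 0 <= s -> s <= X * expR e -> p + e <= - q ->
    l * s < d / 4 * X * expR (- q).
  move=> s0 se pe.
  apply: (@le_lt_trans _ _ (l * (X * expR e))); first by rewrite ler_pM2l.
  apply: (@lt_le_trans _ _ (d / 4 * expR p * (X * expR e))).
    by rewrite ltr_pM2r// mulr_gt0// expR_gt0.
  rewrite mulrACA -expRD ler_wpM2l ?ler_expR//.
  by rewrite mulr_ge0// ltW// divr_gt0.
have e1 : l * (b - 3 * d) ^+ k < d / 4 * X * expR (- q).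
  by apply: half h1 _; [rewrite exprn_ge0//; lra|lra].
have e2 : l * (b ^+ k * expR (- (spread l / (l * d)))) < d / 4 * X * expR (- q).
  apply: (half _ (4 * T - spread l / (l * d))).
  - by rewrite mulr_ge0 ?expR_ge0// exprn_ge0// ltW.
  - by rewrite expRD mulrA ler_pM2r ?expR_gt0.
  - by rewrite AE; lra.
by rewrite mulrDr; lra.
Qed.

End window.

(** * Moments of the oscillating difference *)

Section wave.
Context {R : realType}.
Implicit Types (a b om al d t : R) (k : nat).

Definition wave a b om al : R -> R := flat (parab a b) om al 0 1 0 0.

Lemma waveE a b om al t : a < b -> a < t < b ->
  wave a b om al t =
  expR (- ((t - a) * (b - t))^-1) * sin (phase (parab a b) om al t).
Proof.
move=> ab tab; rewrite /wave /flat parab_gt0// tab expr0 invr1 mulr1.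
by rewrite !hornerC mul1r mul0r !addr0 horner_parab.
Qed.

Lemma normr_wave_le a b om al t : a < b -> a < t < b ->
  `|wave a b om al t| <= expR (- ((t - a) * (b - t))^-1).
Proof.
move=> ab tab; rewrite waveE// normrM ger0_norm ?expR_ge0//.
by rewrite ler_piMr ?expR_ge0// sin_max.
Qed.

Lemma wave_out a b om al t : a < b -> ~~ (a < t < b) -> wave a b om al t = 0.
Proof. by move=> ab nt; rewrite /wave /flat parab_gt0// (negbTE nt). Qed.

Lemma continuous_wave a b om al : continuous (wave a b om al).
Proof. exact: continuous_flat. Qed.

(** The phase varies by at most 1 / 2 when ln w varies by 2 * spread l; since
    ln x <= x, this covers a factor 2 * spread l on w. *)
Definition freq (l : R) : R := (4 * spread l)^-1.

Lemma spread_ge (l : R) : 18 <= spread l.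
Proof. by rewrite /spread lerDr mulr_ge0// sqr_ge0. Qed.

(** The equation on al puts a crest of the sine at w = (b - a) * d.  For b - t
    between d / spread (b - a) and 3 * d, the ratio of w to this value stays
    between 1 / (2 * spread (b - a)) and 3, so the phase moves away from the
    crest by at most 1 / 2. *)
Lemma sin_phase_ge_half a b al d (m : nat) t : a < t < b -> 0 < d ->
  6 * d <= b - a ->
  al - freq (b - a) * ln ((b - a) * d) = pi / 2 + (pi *+ 2) *+ m ->
  d / spread (b - a) <= b - t <= 3 * d ->
  1 / 2 <= sin (phase (parab a b) (freq (b - a)) al t).
Proof.
set l := b - a => /andP[at_ tb] d0 dl phE /andP[u1 u2].
have lE : l = b - a by [].
have A18 := spread_ge l; have A0 : 0 < spread l by lra.
have l0 : 0 < l by lra.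
have ld0 : 0 < l * d by rewrite mulr_gt0.
set w := (t - a) * (b - t).
have w0 : 0 < w by rewrite mulr_gt0 ?subr_gt0.
have r1 : w / (l * d) <= 2 * spread l.
  apply: (@le_trans _ _ 3); last by lra.
  rewrite ler_pdivrMr// /w; apply: (@le_trans _ _ (l * (3 * d))); last by lra.
  by apply: ler_pM; lra.
have r2 : (w / (l * d))^-1 <= 2 * spread l.
  rewrite invf_div ler_pdivrMr//.
  have : d <= spread l * (b - t) by rewrite mulrC -ler_pdivrMr.
  have : l / 2 <= t - a by lra.
  have : 0 < b - t by lra.
  rewrite /w; move: (b - t) (t - a) (spread l) A0 => u v A A0 u0 lv dA.
  have : l / 2 * d <= v * (A * u) by apply: ler_pM; lra.
  by lra.
have r0 : 0 < w / (l * d) by rewrite divr_gt0.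
have lnr : `|freq l * ln (w / (l * d))| <= 1 / 2.
  have f0 : 0 < freq l by rewrite invr_gt0 mulr_gt0.
  rewrite normrM gtr0_norm//.
  have -> : 1 / 2 = freq l * (2 * spread l) :> R.
    by rewrite /freq; field; rewrite gt_eqF.
  rewrite ler_pM2l// ler_norml; apply/andP; split.
    rewrite lerNl -lnV ?posrE// (le_trans _ r2)// ltW// ln_sublinear//.
    by rewrite invr_gt0.
  by rewrite (le_trans _ r1)// ltW// ln_sublinear.
apply: le_trans (cos_ge_half _ lnr) _.
rewrite /phase horner_parab -/w.
have -> : al - freq l * ln w =
    - (freq l * ln (w / (l * d))) + pi / 2 + (pi *+ 2) *+ m.
  by rewrite -addrA -phE ln_div ?posrE//; ring.
by rewrite (periodicn (@sinD2pi R)) sinDpihalf cosN.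
Qed.

Lemma wave_moment_main a b al d m k t (l := b - a) : 0 < a -> 0 < d ->
  6 * d <= l -> al - freq l * ln (l * d) = pi / 2 + (pi *+ 2) *+ m ->
  b - 2 * d <= t <= b - d ->
  1 / 2 * (b - 2 * d) ^+ k * expR (- (2 / (l * d))) <= t ^+ k * wave a b (freq l) al t.
Proof.
move=> a0 d0 dl phE /andP[t1 t2].
have lE : l = b - a by [].
have ab : a < b by lra.
have tab : a < t < b by lra.
have l0 : 0 < l by lra.
rewrite waveE// [1 / 2 * _]mulrC -mulrA; apply: ler_pM.
- by rewrite exprn_ge0//; lra.
- by rewrite mulr_ge0 ?expR_ge0//; lra.
- by rewrite lerXn2r ?nnegrE//; lra.
- rewrite mulrC; apply: ler_pM; [by rewrite expR_ge0|by lra| |].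
    have h : l / 2 * d <= (t - a) * (b - t) by apply: ler_pM; lra.
    have ld0 : 0 < l * d by rewrite mulr_gt0.
    by rewrite ler_expR lerN2 -[leRHS]invf_div lef_pV2 ?posrE; lra.
  apply: (@sin_phase_ge_half _ _ _ d m) => //.
  rewrite ler_pdivrMr; last by have := spread_ge (b - a); lra.
  have : d * 18 <= d * spread (b - a) by rewrite ler_pM2l// spread_ge.
  have : d * spread (b - a) <= (b - t) * spread (b - a).
    by rewrite ler_pM2r; have := spread_ge (b - a); lra.
  lra.
Qed.

(** Left of b - 3 * d the factor t ^ k is small, right of
    b - d / spread (b - a) the factor exp (- 1 / w) is small, and in between the
    wave is positive. *)
Lemma wave_moment_rest a b al d m k t (l := b - a) : 0 < a -> 0 < d ->
  6 * d <= l -> al - freq l * ln (l * d) = pi / 2 + (pi *+ 2) *+ m ->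
  a <= t <= b ->
  - ((b - 3 * d) ^+ k + b ^+ k * expR (- (spread l / (l * d)))) <=
  t ^+ k * wave a b (freq l) al t.
Proof.
move=> a0 d0 dl phE /andP[t1 t2].
have lE : l = b - a by [].
have ab : a < b by lra.
have l0 : 0 < l by lra.
have b0 : 0 < b by lra.
have L1 : 0 <= (b - 3 * d) ^+ k by rewrite exprn_ge0//; lra.
have L2 : 0 <= b ^+ k * expR (- (spread l / (l * d))).
  by rewrite mulr_ge0 ?expR_ge0// exprn_ge0// ltW.
have tk : 0 <= t ^+ k by rewrite exprn_ge0//; lra.
have [tab|ntab] := boolP (a < t < b); last first.
  by rewrite wave_out// mulr0; lra.
have t0 : 0 <= t by lra.
have A0 : 0 < spread l by have := spread_ge l; lra.
have w0 : 0 < (t - a) * (b - t) by rewrite mulr_gt0; lra.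
have absk (s e : R) : t ^+ k <= s -> `|wave a b (freq l) al t| <= e ->
    - (s * e) <= t ^+ k * wave a b (freq l) al t.
  move=> ts we; apply: lerNnormlW; rewrite normrM ger0_norm//.
  exact: ler_pM.
have wle := normr_wave_le a b (freq l) al t ab tab.
have [tl|tr] := leP t (b - 3 * d).
  have tk1 : t ^+ k <= (b - 3 * d) ^+ k.
    by apply: lerXn2r => //; rewrite nnegrE; lra.
  have w1 : `|wave a b (freq l) al t| <= 1.
    by rewrite (le_trans wle)// expR_le1 lerNl oppr0 invr_ge0 ltW.
  by have := absk _ _ tk1 w1; lra.
have [um|ur] := leP (d / spread l) (b - t).
  apply: (@le_trans _ _ 0); first by lra.
  rewrite mulr_ge0// waveE// mulr_ge0 ?expR_ge0//.
  apply: (@le_trans _ _ (1 / 2)); first by lra.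
  by apply: (@sin_phase_ge_half _ _ _ d m) => //; rewrite um; lra.
have tk1 : t ^+ k <= b ^+ k by apply: lerXn2r => //; rewrite nnegrE ltW.
have w1 : `|wave a b (freq l) al t| <= expR (- (spread l / (l * d))).
  rewrite (le_trans wle)// ler_expR lerN2 -[leLHS]invf_div.
  rewrite lef_pV2 ?posrE ?w0 ?divr_gt0 ?mulr_gt0//.
  by rewrite -[leRHS]mulrA; apply: ler_pM; lra.
by have := absk _ _ tk1 w1; lra.
Qed.

End wave.

Section wave_moment.
Context {R : realType}.
Implicit Types (a b om al d t : R) (k : nat).
Local Notation leb := (@lebesgue_measure R).

Lemma continuous_itv_integrable a b (g : R -> R) : continuous g ->
  leb.-integrable `[a, b] (EFin \o g).
Proof.
move=> cg; apply: continuous_compact_integrable; first exact: segment_compact.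
exact: continuous_subspaceT.
Qed.

(** Adding the constant lam of [wave_moment_rest] makes the integrand nonnegative,
    so its integral over [a, b] is at least its integral over
    [b - 2 * d, b - d]. *)
Lemma wave_moment_gt0 a b al d m k (l := b - a) : 0 < a -> 0 < d ->
  6 * d <= l -> al - freq l * ln (l * d) = pi / 2 + (pi *+ 2) *+ m ->
  (4 * l + 2 / l) * b <= k%:R * d ^+ 2 ->
  k%:R * d ^+ 2 <= 2 * (4 * l + 2 / l) * b ->
  0 < \int[leb]_(t in `[a, b]) (t ^+ k * wave a b (freq l) al t).
Proof.
move=> a0 d0 dl phE k1 k2.
have lE : l = b - a by [].
have ab : a < b by lra.
set lam := (b - 3 * d) ^+ k + b ^+ k * expR (- (spread l / (l * d))).
set mu := 1 / 2 * (b - 2 * d) ^+ k * expR (- (2 / (l * d))).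
have dom : l * lam < d * mu by apply: window_dominates => //; lra.
have l0 : 0 < l by lra.
pose h t := t ^+ k * wave a b (freq l) al t.
have ch : continuous h.
  by move=> t; apply: cvgM; [exact: exprn_continuous|exact: continuous_wave].
have ih : leb.-integrable `[a, b] (EFin \o h).
  exact: continuous_itv_integrable.
have il : leb.-integrable `[a, b] (EFin \o cst lam).
  by apply: continuous_itv_integrable => t; exact: cvg_cst.
have lam0 : 0 <= lam.
  rewrite addr_ge0// ?exprn_ge0//; first lra.
  by rewrite mulr_ge0 ?expR_ge0// exprn_ge0//; lra.
have E1 : \int[leb]_(t in `[a, b]) (h t + lam) =
    \int[leb]_(t in `[a, b]) h t + lam * l.
  rewrite RintegralD// Rintegral_cst//= lebesgue_measure_itv/= lte_fin ab.
  by rewrite -EFinD.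
have ihl : leb.-integrable `[a, b] (EFin \o (fun t => h t + lam)).
  apply: continuous_itv_integrable => t.
  by apply: cvgD; [exact: ch|exact: cvg_cst].
have E2 : mu * d <= \int[leb]_(t in `[a, b]) (h t + lam).
  rewrite -lee_fin /Rintegral fineK; last exact: integrable_fin_num ihl.
  pose J : set (measurableTypeR R) := `[b - 2 * d, b - d]%classic.
  have mJ : measurable J by exact: measurable_itv.
  have Jab : J `<=` `[a, b].
    by move=> t; rewrite /J/= !in_itv/= => /andP[? ?]; lra.
  have mh : measurable_fun `[a, b] (fun t => (h t + lam)%:E).
    exact: measurable_int ihl.
  have h0 t : `[a, b]%classic t -> (0 <= (h t + lam)%:E)%E.
    rewrite /= in_itv/= => tab; rewrite lee_fin.
    have := wave_moment_rest a b al d m k t a0 d0 dl phE tab.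
    by rewrite -/(h t) -/lam; lra.
  have muJ : leb J = d%:E.
    rewrite lebesgue_measure_itv/= lte_fin ifT; last by lra.
    by rewrite -EFinD; congr EFin; ring.
  apply: (@le_trans _ _ (\int[leb]_(t in J) (h t + lam)%:E)%E).
    rewrite EFinM -muJ -integral_cst//.
    have mu0 : 0 <= mu by rewrite !mulr_ge0 ?expR_ge0// exprn_ge0//; lra.
    apply: ge0_le_integral => //.
      exact: (measurable_funS _ Jab mh).
    move=> t; rewrite /J/= in_itv/= => tJ; rewrite lee_fin.
      have := wave_moment_main a b al d m k t a0 d0 dl phE tJ.
      by rewrite -/(h t) -/mu; lra.
  exact: ge0_subset_integral.
rewrite E1 in E2.
rewrite -(ltrD2r (lam * l)) add0r; apply: lt_le_trans E2.
by rewrite ![_ * d]mulrC [lam * l]mulrC.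
Qed.

End wave_moment.

Section exists_moment.
Context {R : realType}.
Implicit Types (a b om al d t : R) (k : nat).
Local Notation leb := (@lebesgue_measure R).

(** The crests of the sine are at w = exp ((al - pi / 2 - 2 * pi * m) / om), which
    tends to 0 with m. *)
Lemma exists_small_peak om l al eta : 0 < om -> 0 < l -> 0 < eta ->
  exists d m, [/\ 0 < d, d < eta &
    al - om * ln (l * d) = pi / 2 + (pi *+ 2) *+ m :> R].
Proof.
move=> om0 l0 eta0.
set y := al - pi / 2 - om * ln (l * eta).
pose m := Num.bound `|y|.
have ym : y < m%:R by rewrite (le_lt_trans (ler_norm y))// archi_boundP.
rewrite /y in ym.
have pm : m%:R <= (pi *+ 2) *+ m :> R.
  have p1 : 1 <= pi *+ 2 :> R.
    have -> : pi *+ 2 = 2 * pi :> R by rewrite mulr_natl.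
    by have := @pi_ge2 R; move: (pi : R) => p; lra.
  by rewrite lerMn2r p1 orbT.
pose s := (al - pi / 2 - (pi *+ 2) *+ m) / om.
have sE : om * s = al - pi / 2 - (pi *+ 2) *+ m by rewrite /s mulrC divfK// gt_eqF.
exists (expR s / l), m; split.
- by rewrite divr_gt0// expR_gt0.
- rewrite ltr_pdivrMr// [ltRHS]mulrC -[ltRHS]lnK ?posrE ?mulr_gt0// ltr_expR.
  by rewrite -(ltr_pM2l om0) sE; lra.
- by rewrite [l * _]mulrC divfK ?gt_eqF// expRK sE; lra.
Qed.

Lemma exists_wave_moment_gt0 a b al N : 0 < a -> a < b ->
  exists2 k, (N < k)%N &
    0 < \int[leb]_(t in `[a, b]) (t ^+ k * wave a b (freq (b - a)) al t).
Proof.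
move=> a0 ab.
set l := b - a.
have l0 : 0 < l by rewrite subr_gt0.
have b0 : 0 < b by lra.
have A18 := spread_ge l.
(* The window of [window_dominates] is c <= k * d ^ 2 <= 2 * c; rounding
   c / d ^ 2 up stays inside it as soon as c / d ^ 2 >= 1. *)
pose c := (4 * l + 2 / l) * b.
have c0 : 0 < c by rewrite mulr_gt0// addr_gt0// ?divr_gt0// mulr_gt0.
have N0 : 0 < N.+1%:R :> R by rewrite ltr0n.
pose eta := Num.min (l / 6) (Num.min 1 (c / N.+1%:R)).
have eta0 : 0 < eta by rewrite /eta !lt_min; apply/and3P; split; rewrite ?divr_gt0.
have om0 : 0 < freq l by rewrite invr_gt0 mulr_gt0//; lra.
have [d [m [d0 + phE]]] := exists_small_peak (freq l) l al eta om0 l0 eta0.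
rewrite /eta !lt_min => /and3P[dl d1 dN].
have dd0 : 0 < d ^+ 2 by rewrite exprn_gt0.
have yN : N.+1%:R <= c / d ^+ 2.
  rewrite ler_pdivlMr// mulrC -ler_pdivlMr// (le_trans _ (ltW dN))//.
  by rewrite expr2 ger_pMl// ltW.
set y := c / d ^+ 2 in yN.
have y1 : 1 <= y by apply: le_trans yN; rewrite ler1n.
have y0 : 0 <= y by lra.
have yd : y * d ^+ 2 = c by rewrite divfK// gt_eqF.
exists (Num.truncn y).+1.
  by rewrite -(ltr_nat R) (lt_trans _ (truncnS_gt y))// (lt_le_trans _ yN)// ltr_nat.
apply: (wave_moment_gt0 a b al d m) => //.
- by rewrite -/l; lra.
- by rewrite -/l -/c -yd ler_pM2r// ltW// truncnS_gt.
- rewrite -/l -mulrA -/c -yd mulrA ler_pM2r// -natr1.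
  by have := truncn_le y; rewrite y0; lra.
Qed.

(** The integral equals cos al * S + sin al * C, which takes opposite values at 0
    and pi. *)
Lemma exists_balanced_phase a b om : a < b ->
  exists al, \int[leb]_(t in `[a, b]) wave a b om al t = 0.
Proof.
move=> ab.
have iw al : leb.-integrable `[a, b] (EFin \o wave a b om al).
  exact/continuous_itv_integrable/continuous_wave.
set S := \int[leb]_(t in `[a, b]) wave a b om 0 t.
set C := \int[leb]_(t in `[a, b]) wave a b om (pi / 2) t.
have waveD al t : wave a b om al t =
    cos al * wave a b om 0 t + sin al * wave a b om (pi / 2) t.
  have [tab|ntab] := boolP (a < t < b); last by rewrite !wave_out// !mulr0 addr0.
  rewrite !waveE// /phase sub0r [pi / 2 - _]addrC sinDpihalf.
  by rewrite sinB sinN cosN; ring.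
have iE al : \int[leb]_(t in `[a, b]) wave a b om al t = cos al * S + sin al * C.
  under eq_Rintegral do rewrite waveD.
  rewrite RintegralD//; last 2 first.
  - exact: (integrableZl _ (cos al) (iw 0)).
  - exact: (integrableZl _ (sin al) (iw (pi / 2))).
  by rewrite !RintegralZl.
have cI : continuous (fun al => cos al * S + sin al * C).
  by move=> al; apply: cvgD; apply: cvgM; (try exact: cvg_cst);
    [exact: continuous_cos|exact: continuous_sin].
have [|al _ alE] := @IVT R _ 0 pi 0 (@pi_ge0 R) (continuous_subspaceT cI).
  rewrite cos0 sin0 cospi sinpi !mul0r !addr0 mul1r mulN1r.
  by rewrite ge_min le_max; case: (leP 0 S) => s0; lra.
by exists al; rewrite iE.
Qed.

End exists_moment.

(** * The pair of measures *)

Section pair.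
Context {R : realType}.
Implicit Types (a b om al c t : R) (k : nat).
Local Notation leb := (@lebesgue_measure R).

Lemma rippledB a b om al t : a < b ->
  rippled a b om al t - rippled a b om (al + pi) t = 2 * wave a b om al t.
Proof.
move=> ab; have [tab|ntab] := boolP (a < t < b); last first.
  by rewrite !rippled_out// wave_out// subrr mulr0.
rewrite waveE// /rippled /flat parab_gt0// tab !hornerC horner_parab /phase.
by rewrite [al + pi - _]addrAC sinDpi expr0 invr1; ring.
Qed.

Lemma waveDpi a b om al t : wave a b om (al + pi) t = - wave a b om al t.
Proof.
rewrite /wave /flat; case: ifP => _; last by rewrite oppr0.
by rewrite !hornerC /phase [al + pi - _]addrAC sinDpi; ring.
Qed.

Lemma integrable_moment a b k (g : R -> R) : continuous g ->
  leb.-integrable `[a, b] (EFin \o (fun t => t ^+ k * g t)).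
Proof.
move=> cg; apply: continuous_itv_integrable => t.
by apply: cvgM; [exact: exprn_continuous|exact: cg].
Qed.

Lemma rippled_momentB a b om al k : a < b ->
  \int[leb]_(t in `[a, b]) (t ^+ k * rippled a b om al t) -
  \int[leb]_(t in `[a, b]) (t ^+ k * rippled a b om (al + pi) t) =
  2 * \int[leb]_(t in `[a, b]) (t ^+ k * wave a b om al t).
Proof.
move=> ab; rewrite -RintegralB//; [|exact/integrable_moment/continuous_rippled..].
rewrite -RintegralZl//; last exact/integrable_moment/continuous_wave.
by apply: eq_Rintegral => t _; rewrite -mulrBr rippledB// mulrCA.
Qed.

(** If the k-th moment of the wave is positive, that of the density is positive
    too, and it is at most b ^ k times the mass. *)
Lemma rippled_mass_gt0 a b al : 0 < a -> a < b ->
  0 < \int[leb]_(t in `[a, b]) rippled a b (freq (b - a)) al t.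
Proof.
move=> a0 ab; set om := freq _.
have [k _ Nk] := exists_wave_moment_gt0 a b al 0 a0 ab.
have b0 : 0 < b by lra.
rewrite -(pmulr_rgt0 _ (exprn_gt0 k b0)) -RintegralZl//; last first.
  exact/continuous_itv_integrable/continuous_rippled.
have ib c : leb.-integrable `[a, b] (EFin \o (fun t => c * rippled a b om al t)).
  apply: continuous_itv_integrable => t.
  by apply: cvgM; [exact: cvg_cst|exact: continuous_rippled].
apply: (@lt_le_trans _ _ (\int[leb]_(t in `[a, b]) (t ^+ k * rippled a b om al t))).
  have := rippled_momentB a b om al k ab.
  have : 0 <= \int[leb]_(t in `[a, b]) (t ^+ k * rippled a b om (al + pi) t).
    apply: Rintegral_ge0 => t /=; rewrite in_itv/= => /andP[t1 t2].
    by rewrite mulr_ge0 ?rippled_ge0// exprn_ge0//; lra.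
  by move: Nk; rewrite -/om; lra.
apply: le_Rintegral => //; first exact/integrable_moment/continuous_rippled.
move=> t /=; rewrite in_itv/= => /andP[t1 t2].
by rewrite ler_wpM2r ?rippled_ge0//; apply: lerXn2r => //; rewrite nnegrE; lra.
Qed.

Lemma integral_rippled a b om al c k (D : set (measurableTypeR R)) :
  a < b -> `[a, b] `<=` D ->
  (\int[leb]_(t in D) (t ^+ k * (c * rippled a b om al t))%:E)%E =
  (c * \int[leb]_(t in `[a, b]) (t ^+ k * rippled a b om al t))%:E.
Proof.
move=> ab abD; rewrite -RintegralZl//; last exact/integrable_moment/continuous_rippled.
rewrite /Rintegral fineK; last first.
  apply: integrable_fin_num => //.
  exact: (integrableZl _ c (integrable_moment a b k _ (continuous_rippled a b om al))).
rewrite [LHS]integral_mkcond [RHS]integral_mkcond.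
apply: eq_integral => t _; rewrite !patchE.
have [tab|] := boolP (t \in `[a, b]%classic).
  rewrite ifT; first by rewrite mulrCA.
  by rewrite inE; apply: abD; rewrite -inE.
move=> /negP nab; case: ifP => // _; rewrite rippled_out// ?mulr0//.
by apply/negP => /andP[t1 t2]; apply: nab; rewrite inE/= in_itv/= !ltW.
Qed.

End pair.

Lemma exists_strictly_increasing (P : nat -> nat -> Prop) :
  (forall n N, exists2 k, (N < k)%N & P n k) ->
  exists l : nat -> nat,
    [/\ forall n, (0 < l n)%N, forall m n, (m < n)%N -> (l m < l n)%N &
        forall n, P n (l n)].
Proof.
move=> ex.
have /choice[nxt nxtP] : forall p : nat * nat, exists k, (p.2 < k)%N /\ P p.1 k.
  by move=> [n N]; have [k] := ex n N; exists k.
pose l := fix l n := if n is n'.+1 then nxt (n, l n') else nxt (0%N, 0%N).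
exists l; split.
- by case=> [|n]; [exact: (nxtP (0, 0)%N).1|exact: leq_trans (nxtP (n.+1, l n)).1].
- have lS i : (l i < l i.+1)%N by exact: (nxtP (i.+1, l i)).1.
  by move=> m n; apply: (homo_ltn (r := fun x y => (x < y)%N)) => //; exact: ltn_trans.
- by case=> [|n]; [exact: (nxtP (0, 0)%N).2|exact: (nxtP (n.+1, l n)).2].
Qed.

Theorem theorem21 (R : realType) (a b : R) (a_gt0 : 0 < a) (ltab : a < b) :
  exists (mu_f mu_g : probability (measurableTypeR R) R) (f g : R -> R)
         (l : nat -> nat),
    (absolutely_continuous mu_f /\ absolutely_continuous mu_g) /\
    (supported_on mu_f `[a, b] /\ supported_on mu_g `[a, b]) /\
    (has_density mu_f f /\ has_density mu_g g) /\
    (smooth f /\ smooth g) /\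
    (fsupp f `<=` `[a, b] /\ fsupp g `<=` `[a, b]) /\
    (unimodal f /\ unimodal g) /\
    (forall n, (0 < l n)%N) /\
    (forall m n, (m < n)%N -> (l m < l n)%N) /\
    (forall n, odd n -> (moment mu_f (l n) < moment mu_g (l n))%E) /\
    (forall n, ~~ odd n -> (moment mu_g (l n) < moment mu_f (l n))%E).
Proof.
pose leb := @lebesgue_measure R.
set om := freq (b - a).
have l0 : 0 < b - a by rewrite subr_gt0.
have A18 := spread_ge (b - a).
have om0 : 0 < om by rewrite invr_gt0 mulr_gt0//; lra.
have omab : om * (b - a) ^+ 2 < 1.
  rewrite /om /freq mulrC ltr_pdivrMr ?mul1r ?mulr_gt0//; last by lra.
  by rewrite /spread; have := sqr_ge0 (b - a); lra.
have [al al0] := exists_balanced_phase a b om ltab.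
pose mass be := \int[leb]_(t in `[a, b]) (t ^+ 0 * rippled a b om be t).
have massE be : mass be = \int[leb]_(t in `[a, b]) rippled a b om be t.
  by apply: eq_Rintegral => t _; rewrite mul1r.
have mass0 : 0 < mass al by rewrite massE rippled_mass_gt0.
have mass_eq : mass (al + pi) = mass al.
  apply/eqP; rewrite eq_sym -subr_eq0 rippled_momentB//.
  under eq_Rintegral do rewrite expr0 mul1r.
  by rewrite al0 mulr0.
pose c := (mass al)^-1.
have c0 : 0 < c by rewrite invr_gt0.
have dens be : mass be = mass al ->
    exists mu, has_density mu (fun t => c * rippled a b om be t).
  move=> mbe; apply: exists_density.
  - apply: continuous_measurable_fun => t.
    by apply: cvgM; [exact: cvg_cst|exact: continuous_rippled].
  - by move=> t; rewrite mulr_ge0 ?rippled_ge0// ltW.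
  - have := integral_rippled a b om be c 0 setT ltab (@subsetT _ _).
    rewrite -/(mass be) mbe /c mulVf ?gt_eqF// => <-.
    by apply: eq_integral => t _; rewrite mul1r.
have [mu_f df] := dens al erefl.
have [mu_g dg] := dens (al + pi) mass_eq.
pose N k := \int[leb]_(t in `[a, b]) (t ^+ k * wave a b om al t).
have momE be mu k : has_density mu (fun t => c * rippled a b om be t) ->
    moment mu k = (c * \int[leb]_(t in `[a, b]) (t ^+ k * rippled a b om be t))%:E.
  move=> dmu; rewrite (moment_density _ _ _ dmu) integral_rippled// => t /=.
  by rewrite !in_itv/= andbT => /andP[at_ _]; lra.
have ex (n M : nat) : exists2 k, (M < k)%N & if odd n then N k < 0 else 0 < N k.
  case: (odd n); last exact: exists_wave_moment_gt0.
  have [k Mk Nk] := exists_wave_moment_gt0 a b (al + pi) M a_gt0 ltab.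
  exists k => //; rewrite -oppr_gt0; move: Nk; rewrite -/om.
  under eq_Rintegral do rewrite waveDpi mulrN -mulN1r.
  rewrite RintegralZl// ?mulN1r//.
  exact/integrable_moment/continuous_wave.
have [l [l_gt0 l_incr lP]] := exists_strictly_increasing _ ex.
exists mu_f, mu_g, (fun t => c * rippled a b om al t).
exists (fun t => c * rippled a b om (al + pi) t), l.
have supp be mu : has_density mu (fun t => c * rippled a b om be t) ->
    supported_on mu `[a, b].
  move=> /has_density_supported; apply; first exact: measurable_itv.
  move=> t /= nab; rewrite rippled_out// ?mulr0//.
  by apply/negP => /andP[t1 t2]; apply: nab; rewrite in_itv/= !ltW.
split.
  by split; [exact: has_density_dominates df|exact: has_density_dominates dg].
split; first by split; [exact: supp df|exact: supp dg].
split; first by split.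
split; first by split; exact: smooth_flat.
split; first by split; exact: fsupp_rippled.
split; first by split; apply: unimodal_rippled => //; exact: ltW.
split; first exact: l_gt0.
split; first exact: l_incr.
split.
- move=> n on; have := lP n; rewrite on => Nn.
  rewrite (momE _ _ _ df) (momE _ _ _ dg) lte_fin ltr_pM2l// -subr_lt0.
  by rewrite rippled_momentB// pmulr_rlt0.
- move=> n /negbTE on; have := lP n; rewrite on => Nn.
  rewrite (momE _ _ _ df) (momE _ _ _ dg) lte_fin ltr_pM2l// -subr_gt0.
  by rewrite rippled_momentB// pmulr_rgt0.
Qed.
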